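(* Let $G$ be a $k$-uniform linear oriented hypergraph with incidence dual $G^*$ and intersection graph $\Lambda(G)$. If $\lambda$ is an eigenvalue of $A(\Lambda(G))$ (or of $A(G^* )$), then $\lambda\le k$.
   Context: A hypergraph $H=(V,E,\mathcal I)$ consists of a finite set $V$ of vertices, a finite family $E=(e_\iota)_{\iota\in\Omega}$ of subsets of $V$ (the edges; an edge may be empty, and edges with different indices are regarded as different even if they coincide as sets) and its incidences $\mathcal I$. All hypergraphs are simple: each vertex $v\in e$ is incident with $e$ exactly once, so $\mathcal I=\{(v,e): v\in e\}$. $H$ is linear if $|e\cap f|\le 1$ for any two edges $e,f$ with distinct indices; it is $k$-uniform if every edge has exactly $k$ elements. An oriented hypergraph is a pair $G=(H,\sigma)$ with $\sigma:\mathcal I\to\{+1,-1\}$; hypergraph terminology for $G$ refers to $H$. For an oriented hypergraph with vertices $v_1,\dots,v_n$, an edge $e$ and distinct $v_i,v_j\in e$, put $\mathrm{sgn}_e(v_i,v_j)=-\sigma(v_i,e)\sigma(v_j,e)$. The adjacency matrix $A=(a_{ij})\in\mathbb R^{n\times n}$ has $a_{ij}=\sum_{e}\mathrm{sgn}_e(v_i,v_j)$ for $i\ne j$, the sum being over all edges $e$ containing both $v_i$ and $v_j$ (so $a_{ij}=0$ if there are none), and $a_{ii}=0$. It is symmetric, so its eigenvalues are real. The incidence dual $G^*$ has vertex set $E$ and edge family $V$, where $e$ is incident with $v$ in $G^*$ iff $v$ is incident with $e$ in $G$; its orientation is $\sigma^*(e,v)=\sigma(v,e)$. Intersection graph: for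 a linear $G$, $\Lambda(G)$ is the oriented hypergraph with vertex set $E(G)$ and one edge $ef=\{e,f\}$ for each pair of distinct $e,f\in E(G)$ with $e\cap f\ne\varnothing$; if $v\in e\cap f$ then $\sigma_{\Lambda(G)}(e,ef)=\sigma_G(v,e)$ and $\sigma_{\Lambda(G)}(f,ef)=\sigma_G(v,f)$. *)

(* Defs.v *)
From HB Require Import structures.
From mathcomp Require Import all_boot all_order all_algebra.

Set Implicit Arguments.
Unset Strict Implicit.
Unset Printing Implicit Defensive.

Import Order.TTheory GRing.Theory Num.Theory.
Local Open Scope ring_scope.

(* The edges form a family of subsets of V indexed by E, so edges with distinct
   indices are distinct even when they are equal as sets. The values of [sigma]
   outside the incidences are unconstrained and never used. *)
Record oriented_hypergraph (V E : finType) := OrientedHypergraph {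
  edge : E -> {set V};
  sigma : V -> E -> int;
  sigmaP : forall v e, v \in edge e -> sigma v e = 1 \/ sigma v e = -1
}.

Section OrientedHypergraph.
Variables (V E : finType) (G : oriented_hypergraph V E).

Definition linear_hypergraph : Prop :=
  forall e f : E, e != f -> (#|edge G e :&: edge G f| <= 1)%N.

Definition uniform (k : nat) : Prop := forall e : E, #|edge G e| = k.

Definition sgn (e : E) (u v : V) : int := - (sigma G u e * sigma G v e).

(* The vertices v_1, ..., v_n are enumerated by [enum_val]. *)
Definition adjacency (R : pzRingType) : 'M[R]_#|V| :=
  \matrix_(i, j)
    if i == j then 0
    else \sum_(e | (enum_val i \in edge G e) && (enum_val j \in edge G e))
           (sgn e (enum_val i) (enum_val j))%:~R.

Definition dual_edge (v : V) : {set E} := [set e | v \in edge G e].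

Fact dual_sigmaP e v :
  e \in dual_edge v -> sigma G v e = 1 \/ sigma G v e = -1.
Proof. by rewrite inE; apply: sigmaP. Qed.

Definition incidence_dual : oriented_hypergraph E V :=
  OrientedHypergraph dual_sigmaP.

Definition meeting_pair (p : {set E}) : bool :=
  [exists e, exists f,
    [&& e != f, edge G e :&: edge G f != set0 & p == [set e; f]]].

Definition intersection_edge : finType := {p : {set E} | meeting_pair p}.

(* A common vertex of the two members of p is chosen; it is unique when G is
   linear (see [intersection_sigmaE]), and the default value 1 is never
   reached. *)
Definition intersection_sigma (e : E) (p : intersection_edge) : int :=
  if [pick v in \bigcap_(f in val p) edge G f] is Some v then sigma G v e
  else 1.

Fact intersection_sigmaP e (p : intersection_edge) :
  e \in val p -> intersection_sigma e p = 1 \/ intersection_sigma e p = -1.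
Proof.
move=> ep; rewrite /intersection_sigma; case: pickP => [v /bigcapP vp|_].
  exact/sigmaP/vp.
by left.
Qed.

Definition intersection_graph : oriented_hypergraph E intersection_edge :=
  OrientedHypergraph intersection_sigmaP.

Lemma intersection_sigmaE (e f : E) (p : intersection_edge) (v : V) :
    linear_hypergraph -> e != f -> val p = [set e; f] ->
    v \in edge G e :&: edge G f ->
  sigma intersection_graph e p = sigma G v e /\
  sigma intersection_graph f p = sigma G v f.
Proof.
move=> linG nef pE vef; rewrite /= /intersection_sigma pE bigcap_setU !big_set1.
case: pickP => [w wef|/(_ v)]; last by rewrite vef.
by have /card_le1_eqP/(_ _ _ wef vef) -> := linG _ _ nef.
Qed.

End OrientedHypergraph.

(* Main.v *)
(* With N the signed edge-vertex incidence matrix of G, the adjacency matrix of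
   the dual is k I - N N^T, and N N^T is positive semidefinite, so its
   eigenvalues are at most k. By linearity two edges share at most one vertex,
   and they share one exactly when they are adjacent in the intersection graph,
   so that graph has the same adjacency matrix as the dual. *)
Require Import Defs.
From HB Require Import structures.
From mathcomp Require Import all_boot all_order all_algebra.

Set Implicit Arguments.
Unset Strict Implicit.
Unset Printing Implicit Defensive.

Import Order.TTheory GRing.Theory Num.Theory.
Local Open Scope ring_scope.

Lemma row_sqr_ge0 (R : realDomainType) n (w : 'rV[R]_n) :
  0 <= (w *m w^T) 0 0.
Proof. by rewrite mxE sumr_ge0 // => j _; rewrite mxE -expr2 sqr_ge0. Qed.

Lemma row_sqr_eq0 (R : realDomainType) n (w : 'rV[R]_n) :
  ((w *m w^T) 0 0 == 0) = (w == 0).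
Proof.
apply/eqP/eqP => [|->]; last by rewrite mul0mx mxE.
rewrite mxE => w0; apply/rowP => j; rewrite mxE.
have sqr_ge0_at i : true -> 0 <= w 0 i * w^T i 0 by rewrite mxE -expr2 sqr_ge0.
have /eqP := psumr_eq0P sqr_ge0_at w0 isT (i := j).
by rewrite mxE mulf_eq0 orbb => /eqP.
Qed.

(** For a row eigenvector [u], the squared norm of [u *m N] is [a - lambda] times that of [u]. The
    former is nonnegative and the latter positive, so [a - lambda] is nonnegative. *)
Lemma eigenvalue_scalar_sub_gram_le (R : realFieldType) m n (a : R)
    (N : 'M[R]_(m, n)) (lambda : R) :
  eigenvalue (a%:M - N *m N^T) lambda -> lambda <= a.
Proof.
case/eigenvalueP => u; rewrite mulmxBr mul_mx_scalar => uA u_neq0.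
have u_gt0 : 0 < (u *m u^T) 0 0.
  by rewrite lt_def row_sqr_ge0 row_sqr_eq0 u_neq0.
have : ((u *m N) *m (u *m N)^T) 0 0 = (a - lambda) * (u *m u^T) 0 0.
  have -> : (u *m N) *m (u *m N)^T = (a - lambda) *: (u *m u^T).
    rewrite trmx_mul mulmxA -(mulmxA u) scalemxAl scalerBl -uA.
    by rewrite opprB addrC subrK.
  by rewrite mxE.
move=> quad; have := row_sqr_ge0 (u *m N).
by rewrite quad pmulr_lge0 // subr_ge0.
Qed.

Section Adjacency.
Variables (V E : finType) (G : oriented_hypergraph V E).

(** Rows are indexed by edges, so that the Gram matrix of the rows compares pairs of edges. The test
    guards against the arbitrary values of [sigma] off the incidences. *)
Definition incidence_mx (R : pzRingType) : 'M[R]_(#|E|, #|V|) :=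
  \matrix_(i, j)
    if enum_val j \in edge G (enum_val i)
    then (sigma G (enum_val j) (enum_val i))%:~R else 0.

Lemma sigma_sqr v e : v \in edge G e -> sigma G v e * sigma G v e = 1.
Proof. by case/sigmaP => ->. Qed.

Lemma adjacency_dualE (R : pzRingType) (k : nat) :
  uniform G k ->
  adjacency (incidence_dual G) R
    = k%:R%:M - incidence_mx R *m (incidence_mx R)^T.
Proof.
move=> unifG; apply/matrixP => i j; rewrite !mxE.
set e := enum_val i; set f := enum_val j.
have -> : \sum_l incidence_mx R i l * (incidence_mx R)^T l j =
    \sum_(v | (v \in edge G e) && (v \in edge G f))
       (sigma G v e * sigma G v f)%:~R.
  rewrite [RHS]big_mkcond (reindex _ (onW_bij _ (@enum_val_bij V))) /=.
  apply: eq_bigr => l _; rewrite !mxE.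
  by do 2![case: ifP => _ //=]; rewrite ?mul0r ?mulr0 // intrM.
rewrite /e /f; case: eqVneq => [<-|_]; last first.
  rewrite mulr0n sub0r -sumrN; apply: eq_big => [v|v _]; first by rewrite !inE.
  by rewrite /sgn mulrNz.
(* On the diagonal, [k] is written as a sum of ones over the vertices of the edge. It cancels
   against the squared signs, leaving the zero diagonal of the adjacency matrix. *)
rewrite mulr1n -(unifG (enum_val i)) -sum1_card natr_sum.
under [X in _ - X]eq_bigl do rewrite andbb.
rewrite [X in _ - X](eq_bigr (fun=> 1%:R)) ?subrr // => v /sigma_sqr ->.
by [].
Qed.

Lemma adjacency_intersection_graphE (R : pzRingType) :
  linear_hypergraph G ->
  adjacency (intersection_graph G) R = adjacency (incidence_dual G) R.
Proof.
move=> linG; apply/matrixP => i j; rewrite !mxE.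
case: (eqVneq i j) => // neij.
have: enum_val i != enum_val j by rewrite (inj_eq enum_val_inj).
move: (enum_val i) (enum_val j) => e f neef {i j neij}.
(* A vertex of the intersection graph is an edge of [G], and its edges are two-element sets: only
   one of them can contain both [e] and [f]. *)
have pairE (p : intersection_edge G) :
    (e \in val p) && (f \in val p) = (val p == [set e; f]).
  apply/andP/eqP => [[]|->]; last by rewrite set21 set22.
  case/existsP: (valP p) => a /existsP[b /and3P[_ _ /eqP ->]].
  rewrite !in_set2 => /pred2P[] eE /pred2P[] fE; move: neef;
    rewrite eE fE ?eqxx //.
  by rewrite setUC.
have [meet0|[v vef]] := set_0Vmem (edge G e :&: edge G f).
  (* If [e] and [f] are disjoint, both sums are empty: there is no common vertex, and a meeting pair
     equal to [[set e; f]] would provide one, in whichever order its members are listed. *)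
  rewrite !big1 // => [v|p].
    by rewrite !inE -in_setI meet0 inE.
  rewrite pairE => /eqP pE; move: (valP p) => /existsP[a /existsP[b]].
  case/and3P=> neab meet_ab /eqP; rewrite pE => efE.
  have:= set21 e f; have:= set22 e f; rewrite efE !in_set2.
  case/pred2P=> fE /pred2P[] eE; move: neef meet_ab.
  - by rewrite fE eE eqxx.
  - by rewrite -fE -eE setIC meet0 eqxx.
  - by rewrite -fE -eE meet0 eqxx.
  - by rewrite fE eE eqxx.
have pP : meeting_pair G [set e; f].
  apply/existsP; exists e; apply/existsP; exists f.
  by rewrite neef eqxx andbT; apply/set0Pn; exists v.
pose p : intersection_edge G := Sub [set e; f] pP.
(* Otherwise each sum has a single term, at [p] on the left and, by linearity, at [v] on the right;
   the signs at [p] are those at [v]. *)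
rewrite (big_pred1 p) => [|q]; last by rewrite pairE -val_eqE.
rewrite (big_pred1 v) => [|w].
  have [eE fE] := intersection_sigmaE linG neef (erefl (val p)) vef.
  by rewrite /sgn eE fE.
rewrite /= !inE -in_setI; apply/idP/eqP => [wef|-> //].
by have /card_le1_eqP/(_ _ _ wef vef) -> := linG _ _ neef.
Qed.

End Adjacency.

Theorem theorem4p4 (R : rcfType) (V E : finType)
    (G : oriented_hypergraph V E) (k : nat) :
  linear_hypergraph G -> uniform G k ->
  forall lambda : R,
    eigenvalue (adjacency (intersection_graph G) R) lambda \/
    eigenvalue (adjacency (incidence_dual G) R) lambda ->
  lambda <= k%:R.
Proof.
move=> linG unifG lambda; rewrite adjacency_intersection_graphE //.
rewrite (adjacency_dualE R unifG).
by case; apply: eigenvalue_scalar_sub_gram_le.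
Qed.
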